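(* Let $\Sigma=\{\mathcal I_j,\mathcal L_j,\mathcal V_k : j=0,\dots,d,\ k=1,\dots,\tilde d\}$ be the set of linear functionals, and $A,G,C,\tilde C,M$ the matrices, defined in the context. Then $\Sigma$ is unisolvent on $\mathbb P_2(S_d)$ if and only if both the affine moment matrix $A$ and the quadratic moment matrix $$H=\begin{pmatrix}G&C\\ \tilde C&M\end{pmatrix}$$ are nonsingular.
   Context: Let $d\ge 2$ and let $S_d\subset\mathbb R^d$ be a nondegenerate $d$-simplex with vertices $\boldsymbol v_0,\dots,\boldsymbol v_d$ and barycentric coordinates $\lambda_0,\dots,\lambda_d$. $F_j$ is the face opposite $\boldsymbol v_j$. $\mathbb P_k(X)$ is the space of (restrictions to $X$ of) polynomials of total degree at most $k$. $\Omega\in L^1(S_d)$ is a probability density, strictly positive a.e. in the interior of $S_d$. For each $j$, the induced face density $\omega_j$ is the normalized conditional trace of $\Omega$ on $F_j$: for every $\phi$ continuous on $F_j$ (extended continuously to $S_d$), $$\int_{F_j}\phi\,\omega_j\,d\boldsymbol x=\lim_{\varepsilon\to0^+}\frac{\int_{\{\lambda_j<\varepsilon\}}\phi\,\Omega\,d\boldsymbol\sigma}{\int_{\{\lambda_j<\varepsilon\}}\Omega\,d\boldsymbol\sigma};$$ it is assumed that this limit exists and defines a probability density $\omega_j\in L^1(F_j)$, positive a.e. on $F_j$ (with respect to $(d-1)$-dimensional Lebesgue measure). Set $\langle f,g\rangle_\Omega=\int_{S_d}fg\,\Omega\,d\boldsymbol\sigma$ and $\langle f,g\rangle_{\omega_j}=\int_{F_j}fg\,\omega_j\,d\boldsymbol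 x$ (functions on $S_d$ are restricted to $F_j$). $\mathbb S_2(S_d)=\{p\in\mathbb P_2(S_d):\langle p,\varphi\rangle_\Omega=0\ \forall\varphi\in\mathbb P_1(S_d)\}$, of dimension $d(d+1)/2$. Let $\tilde d=(d-2)(d+1)/2$. Let $\rho_1,\dots,\rho_{\tilde d}\in\mathbb S_2(S_d)$ be linearly independent, $\mathbb V=\operatorname{span}\{\rho_k\}$, and let $\psi_0,\dots,\psi_d\in\mathbb S_2(S_d)$, $\mathbb W=\operatorname{span}\{\psi_j\}$, be such that $\mathbb S_2(S_d)=\mathbb V\oplus\mathbb W$ (direct sum, not necessarily orthogonal, so $\psi_0,\dots,\psi_d$ is a basis of $\mathbb W$). For each $j$ let $q_j\in\mathbb P_2(F_j)$ satisfy $\langle q_j,\varphi\rangle_{\omega_j}=0$ for all $\varphi\in\mathbb P_1(F_j)$. Functionals: $\mathcal I_j(f)=\langle f,1\rangle_{\omega_j}$, $\mathcal L_j(f)=\langle f,q_j\rangle_{\omega_j}$ ($j=0,\dots,d$), $\mathcal V_k(f)=\langle f,\rho_k\rangle_\Omega$ ($k=1,\dots,\tilde d$). Their number is $\dim\mathbb P_2(S_d)$; ''$\Sigma$ is unisolvent on $\mathbb P_2(S_d)$'' means that the only $p\in\mathbb P_2(S_d)$ annihilated by all functionals in $\Sigma$ is $p=0$. Matrices: $[A]_{ji}=\mathcal I_j(\lambda_i)$, $[G]_{k\ell}=\mathcal V_k(\rho_\ell)$, $[C]_{ki}=\mathcal V_k(\psi_i)$, $[\tilde C]_{j\ell}=\mathcal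 L_j(\rho_\ell)$, $[M]_{ji}=\mathcal L_j(\psi_i)$, with $i,j=0,\dots,d$ and $k,\ell=1,\dots,\tilde d$. If $d=2$ then $\tilde d=0$, the blocks $G,C,\tilde C$ are empty and $H=M$. *)

(* Defs.v *)
From HB Require Import structures.
From mathcomp Require Import all_boot all_order all_algebra.
From mathcomp Require mpoly.
Import -(notations) mpoly.
From mathcomp Require Import all_classical all_reals all_analysis.
From mathcomp Require Import measurable_realfun.
Set Implicit Arguments.
Unset Strict Implicit.
Unset Printing Implicit Defensive.
Import Order.TTheory GRing.Theory Num.Theory.
Import numFieldNormedType.Exports.
Local Open Scope classical_set_scope.
Local Open Scope ring_scope.

(* The library has no measurable structure on row vectors: we take the product
   (equivalently, Borel) sigma-algebra, generated by the coordinates, as it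
   does for tuples. *)
Definition rV_display : measure_display.
Proof. exact: default_measure_display. Qed.

Section measurable_rV.
Context (R : realType) (n : nat).

Let coord (i : 'I_n) (x : 'rV[R]_n) : measurableTypeR R := x ord0 i.

Let rV_set0 : g_sigma_preimage coord set0.
Proof. exact: sigma_algebra0. Qed.

Let rV_setC A : g_sigma_preimage coord A -> g_sigma_preimage coord (~` A).
Proof. exact: sigma_algebraC. Qed.

Let rV_bigcup (F : (set 'rV[R]_n)^nat) :
  (forall i, g_sigma_preimage coord (F i)) ->
  g_sigma_preimage coord (\bigcup_i (F i)).
Proof. exact: sigma_algebra_bigcup. Qed.

HB.instance Definition _ := @isMeasurable.Build rV_display
  'rV[R]_n (g_sigma_preimage coord) rV_set0 rV_setC rV_bigcup.

Lemma measurable_coord (i : 'I_n) :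
  measurable_fun setT (fun x : 'rV[R]_n => x ord0 i : measurableTypeR R).
Proof.
move=> _ Y mY; rewrite setTI; apply: sub_sigma_algebra => /=.
rewrite -bigcup_seq/=; exists i => /=; first by rewrite mem_index_enum.
by exists Y => //; rewrite setTI.
Qed.

Lemma measurable_fun_rV d (T : measurableType d) (f : T -> 'rV[R]_n) :
  (forall i, measurable_fun setT (fun t => f t ord0 i : measurableTypeR R)) ->
  measurable_fun setT f.
Proof.
move=> mf _ A mA; rewrite setTI.
have : g_sigma_preimage (fun i => coord i \o f) `<=` measurable.
  apply: smallest_sub; first exact: sigma_algebra_measurable.
  rewrite -bigcup_seq; apply: bigcup_sub => i _ B [C mC <-].
  by rewrite setTI -[X in measurable X]setTI; exact: mf.
by rewrite g_sigma_preimage_comp; apply; exists A => //; rewrite setTI.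
Qed.

End measurable_rV.

Section lebesgue_rV.
Context (R : realType).

Definition rV_cons n (p : measurableTypeR R * 'rV[R]_n) : 'rV[R]_n.+1 :=
  \row_i oapp (fun k => p.2 ord0 k) p.1 (unlift ord0 i).

Definition rV_uncons n (x : 'rV[R]_n.+1) : measurableTypeR R * 'rV[R]_n :=
  (x ord0 ord0, \row_k x ord0 (lift ord0 k)).

Lemma rV_consK n : cancel (@rV_cons n) (@rV_uncons n).
Proof.
move=> [a x]; rewrite /rV_uncons/rV_cons mxE unlift_none /=; congr pair.
by apply/rowP => k; rewrite !mxE liftK.
Qed.

Lemma measurable_rV_cons n : measurable_fun setT (@rV_cons n).
Proof.
apply: measurable_fun_rV => i; rewrite /rV_cons.
under eq_fun do rewrite mxE.
case: unliftP => [k _|_] /=; last exact: measurable_fst.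
exact: (measurableT_comp (@measurable_coord R n k) measurable_snd).
Qed.

Lemma measurable_rV_uncons n : measurable_fun setT (@rV_uncons n).
Proof.
apply/measurable_fun_pairP; split; first exact: measurable_coord.
apply: measurable_fun_rV => i /=.
under eq_fun do rewrite mxE.
exact: measurable_coord.
Qed.

Section step.
Context n (mu : {sigma_finite_measure set 'rV[R]_n -> \bar R}).

Definition lebesgue_cons : set 'rV[R]_n.+1 -> \bar R :=
  pushforward (@lebesgue_measure R \x mu)%E (@rV_cons n).

Let lebesgue_cons0 : lebesgue_cons set0 = 0%E.
Proof. have mf := @measurable_rV_cons n; exact: measure0. Qed.

Let lebesgue_cons_ge0 A : (0 <= lebesgue_cons A)%E.
Proof. have mf := @measurable_rV_cons n; exact: measure_ge0. Qed.

Let lebesgue_cons_sigma_additive : semi_sigma_additive lebesgue_cons.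
Proof.
have mf := @measurable_rV_cons n; exact: measure_semi_sigma_additive.
Qed.

HB.instance Definition _ := isMeasure.Build _ _ _ lebesgue_cons
  lebesgue_cons0 lebesgue_cons_ge0 lebesgue_cons_sigma_additive.

Let lebesgue_cons_sigma_finite : sigma_finite setT lebesgue_cons.
Proof.
pose leb : {sigma_finite_measure set (measurableTypeR R) -> \bar R} :=
  @lebesgue_measure R.
have /sigma_finiteP[F [TF ndF Foo]] := sigma_finiteT leb.
have /sigma_finiteP[G [TG ndG Goo]] := sigma_finiteT mu.
exists (fun i => @rV_uncons n @^-1` (F i `*` G i)) => [|i].
  rewrite -preimage_bigcup -[LHS](preimage_setT (@rV_uncons n)); congr (_ @^-1` _).
  rewrite -setXTT TF TG predeqE => -[x y]; split.
    move=> [/= [j _ Fjx] [k _ Gky]]; exists (maxn j k) => //; split.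
    - by move: x Fjx; exact/subsetPset/ndF/leq_maxl.
    - by move: y Gky; exact/subsetPset/ndG/leq_maxr.
  by move=> [j _ []/= ? ?]; split; exists j.
have [mF Fi] := Foo i; have [mG Gi] := Goo i; split.
  rewrite -[X in measurable X]setTI; apply: measurable_rV_uncons => //.
  exact: measurableX.
rewrite /lebesgue_cons /pushforward -comp_preimage.
rewrite (_ : _ \o _ = id); last by apply/funext => x /=; rewrite rV_consK.
by rewrite preimage_id product_measure1E// lte_mul_pinfty// ge0_fin_numE.
Qed.

HB.instance Definition _ := Measure_isSigmaFinite.Build _ _ _ lebesgue_cons
  lebesgue_cons_sigma_finite.

End step.

(* n-dimensional Lebesgue measure on Borel sets: the n-fold product of the
   one-dimensional one (see [lebesgue_rV_box]). *)
Fixpoint lebesgue_rV n : {sigma_finite_measure set 'rV[R]_n -> \bar R} :=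
  match n with
  | 0 => \d_(0 : 'rV[R]_0)
  | m.+1 => lebesgue_cons (lebesgue_rV m)
  end.

Lemma lebesgue_rV_box n (A : 'I_n -> set (measurableTypeR R)) :
  (forall i, measurable (A i)) ->
  lebesgue_rV n [set x | forall i, A i (x ord0 i)] =
  (\prod_(i < n) lebesgue_measure (A i))%E.
Proof.
elim: n A => [A _|n IHn A mA].
  by rewrite big_ord0 /= diracE mem_set// => -[].
rewrite big_ord_recl -IHn//= /lebesgue_cons /pushforward.
have mB : measurable [set x : 'rV[R]_n | forall i, A (lift ord0 i) (x ord0 i)].
  rewrite (_ : mkset _ =
    \big[setI/setT]_(i < n) (fun x : 'rV[R]_n => x ord0 i) @^-1` A (lift ord0 i)).
    apply: bigsetI_measurable => i _; rewrite -[X in measurable X]setTI.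
    exact: measurable_coord.
  rewrite -bigcap_seq; apply/seteqP; split => x Ax i; first by move=> _; exact: Ax.
  by apply: Ax; rewrite /= mem_index_enum.
rewrite -product_measure1E//; congr (_ _).
apply/seteqP; split => -[a x] /=.
  move=> Ax; split => [|i].
    by have := Ax ord0; rewrite mxE unlift_none.
  by have := Ax (lift ord0 i); rewrite mxE liftK.
by move=> [Aa Ax] i; rewrite mxE; case: unliftP => [k ->|->].
Qed.

End lebesgue_rV.
Arguments lebesgue_rV {R} n.

Section affine_measure.
Context (R : realType) (m : nat).
Implicit Types (k : nat).

Definition edge_mx k (w : 'I_k.+1 -> 'rV[R]_m) : 'M[R]_(k, m) :=
  \matrix_(i < k) (w (lift ord0 i) - w ord0).

Definition affine_param k (w : 'I_k.+1 -> 'rV[R]_m) (t : 'rV[R]_k) : 'rV[R]_m :=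
  w ord0 + t *m edge_mx w.

Lemma measurable_affine_param k (w : 'I_k.+1 -> 'rV[R]_m) :
  measurable_fun setT (affine_param w).
Proof.
apply: measurable_fun_rV => i.
under eq_fun do rewrite !mxE.
apply: measurable_funD => //; apply: measurable_sum => j.
by apply: measurable_funM => //; exact: measurable_coord.
Qed.

Definition gram_sqrt k (w : 'I_k.+1 -> 'rV[R]_m) : {nonneg R} :=
  NngNum (sqrtr_ge0 (\det (edge_mx w *m (edge_mx w)^T))).

Section image.
Context k (w : 'I_k.+1 -> 'rV[R]_m).

Definition affine_image : set 'rV[R]_m -> \bar R :=
  pushforward (lebesgue_rV k) (affine_param w).

Let affine_image0 : affine_image set0 = 0%E.
Proof. have mf := measurable_affine_param w; exact: measure0. Qed.

Let affine_image_ge0 A : (0 <= affine_image A)%E.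
Proof. have mf := measurable_affine_param w; exact: measure_ge0. Qed.

Let affine_image_sigma_additive : semi_sigma_additive affine_image.
Proof.
have mf := measurable_affine_param w; exact: measure_semi_sigma_additive.
Qed.

HB.instance Definition _ := isMeasure.Build _ _ _ affine_image
  affine_image0 affine_image_ge0 affine_image_sigma_additive.

End image.

(* (k-1)-dimensional Lebesgue (surface) measure on the affine hull of k affinely
   independent points w_0, ..., w_(k-1): the image of Lebesgue measure on
   R^(k-1) under the affine parametrization, times its area factor, the square
   root of the Gram determinant of the edges. The empty family is irrelevant. *)
Definition affine_measure k :
    ('I_k -> 'rV[R]_m) -> {measure set 'rV[R]_m -> \bar R} :=
  match k with
  | 0 => fun=> mzero
  | k'.+1 => fun w => mscale (gram_sqrt w) (affine_image w)
  end.

End affine_measure.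

Section simplex.
Context (R : realType) (m : nat).

Definition hull k (w : 'I_k -> 'rV[R]_m) : set 'rV[R]_m :=
  [set x | exists c : 'I_k -> R, [/\ forall i, 0 <= c i, \sum_i c i = 1 &
    x = \sum_i c i *: w i]].

Implicit Type v : 'I_m.+1 -> 'rV[R]_m.

(* The edges from the first vertex are linearly independent. *)
Definition nondeg_simplex v := row_free (edge_mx v).

Definition face_vertices v (j : 'I_m.+1) : 'I_m -> 'rV[R]_m :=
  fun i => v (lift j i).

Definition face v j := hull (face_vertices v j).

Definition face_measure v j := affine_measure (face_vertices v j).

Definition vertex_mx v : 'M[R]_(m.+1) :=
  \matrix_(i < m.+1) (row_mx 1 (v i) : 'rV[R]_(1 + m)).

(* Barycentric coordinates, obtained by solving the linear system of [baryP]. *)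
Definition bary v (i : 'I_m.+1) (x : 'rV[R]_m) : R :=
  ((row_mx 1 x : 'rV[R]_m.+1) *m invmx (vertex_mx v)) ord0 i.

Lemma mul_vertex_mx v (u : 'rV[R]_m.+1) :
  u *m vertex_mx v =
  row_mx (\sum_i u ord0 i)%:M (\sum_i u ord0 i *: v i) :> 'rV[R]_(1 + m).
Proof.
apply/rowP => k; rewrite mxE.
case: (@split_ordP 1 m k) => l ->; rewrite ?(row_mxEl, row_mxEr) ?mxE.
  rewrite (ord1 l) mulr1n; apply: eq_bigr => i _.
  by rewrite /vertex_mx mxE row_mxEl mxE mulr1.
rewrite summxE; apply: eq_bigr => i _.
by rewrite [RHS]mxE /vertex_mx mxE row_mxEr.
Qed.

Lemma nondeg_simplex_unit v : nondeg_simplex v -> vertex_mx v \in unitmx.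
Proof.
move=> vfree; rewrite -row_free_unit -kermx_eq0; apply/rowV0P => u.
move/sub_kermxP; rewrite mul_vertex_mx -[RHS](@row_mx0 _ 1 1 m).
move=> /(@eq_row_mx _ 1 1 m)[/matrixP/(_ ord0 ord0)]; rewrite !mxE mulr1n => u1 uv.
pose t : 'rV[R]_m := \row_i u ord0 (lift ord0 i).
have : t *m edge_mx v = 0 *m edge_mx v.
  rewrite mul0mx mulmx_sum_row.
  under eq_bigr do rewrite mxE rowK scalerBr.
  move: u1 uv; rewrite !big_ord_recl => u1 uv.
  rewrite sumrB -scaler_suml -[X in X - _](addKr (u ord0 ord0 *: v ord0)) uv.
  rewrite addr0 -opprD -scalerDl u1 scale0r oppr0 //.
move/(row_free_inj vfree) => t0.
have ut i : u ord0 (lift ord0 i) = 0.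
  by have := congr1 (fun x : 'rV_m => x ord0 i) t0; rewrite !mxE.
apply/rowP => i; rewrite mxE; case: (unliftP ord0 i) => [k ->//|->].
by move: u1; rewrite big_ord_recl big1 ?addr0.
Qed.

Lemma baryP v x : nondeg_simplex v ->
  \sum_i bary v i x = 1 /\ \sum_i bary v i x *: v i = x.
Proof.
move=> /nondeg_simplex_unit vu.
have := mul_vertex_mx v ((row_mx 1 x : 'rV[R]_m.+1) *m invmx (vertex_mx v)).
rewrite mulmxKV// => /(@eq_row_mx _ 1 1 m)[/matrixP/(_ ord0 ord0)].
by rewrite !mxE !mulr1n => <- <-.
Qed.

End simplex.

Section spaces.
Context (R : realType) (m : nat).
Local Notation T := 'rV[R]_m.
Implicit Types (X : set T) (f g w : T -> R) (mu : {measure set T -> \bar R}).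

(* In this section a function on X is represented by a function on the whole
   space whose values outside X are irrelevant; equality is equality on X. *)

(* [mpoly.msize] is the total degree plus one (and 0 for the zero polynomial). *)
Definition Pspace k X : set (T -> R) :=
  [set f | exists2 p : mpoly m R, (mpoly.msize p <= k.+1)%N &
    forall x, X x -> f x = meval (fun i => x ord0 i) p].

Definition span_on X k (b : 'I_k -> T -> R) : set (T -> R) :=
  [set f | exists c : 'I_k -> R, forall x, X x -> f x = \sum_i c i * b i x].

Definition free_on X k (b : 'I_k -> T -> R) :=
  forall c : 'I_k -> R, (forall x, X x -> \sum_i c i * b i x = 0) ->
    forall i, c i = 0.

Definition direct_sum_on X (U V W : set (T -> R)) :=
  (forall f, U f <-> exists g h,
     [/\ V g, W h & forall x, X x -> f x = g x + h x]) /\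
  (forall f, V f -> W f -> forall x, X x -> f x = 0).

Definition prob_density mu X w :=
  [/\ mu.-integrable X (EFin \o w),
      {ae mu, forall x, X x -> 0 <= w x} &
      \int[mu]_(x in X) w x = 1].

Definition inner mu X w f g : R := \int[mu]_(x in X) (f x * g x * w x).

Definition orth_quadratic mu X w : set (T -> R) :=
  [set p | Pspace 2 X p /\ forall f, Pspace 1 X f -> inner mu X w p f = 0].

Definition unisolvent (Sigma : set ((T -> R) -> R)) X (P : set (T -> R)) :=
  forall p, P p -> (forall F, Sigma F -> F p = 0) -> forall x, X x -> p x = 0.

(* [w] is the normalized conditional trace of the density [W] on the face
   opposite [v j]; letting f range over the continuous functions on the simplex
   accounts for all continuous functions on the face and all their continuous
   extensions. *)
Definition face_trace (v : 'I_m.+1 -> T) (W : T -> R) (j : 'I_m.+1) w :=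
  forall f, {within hull v, continuous f} ->
    let strip e := hull v `&` [set x | bary v j x < e] in
    (\int[lebesgue_rV m]_(x in strip e) (f x * W x)) /
    (\int[lebesgue_rV m]_(x in strip e) W x) @[e --> 0^'+] -->
    \int[face_measure v j]_(x in face v j) (f x * w x).

End spaces.

(* Main.v *)
(* Orthogonal projection onto P_1 for the density Omega, whose Gram matrix on
   the barycentric coordinates is positive definite because Omega > 0 a.e. in
   the interior, shows that e = (lambda, rho, psi) spans P_2. It has as many
   members as the linearly independent products lambda_i lambda_j, i <= j,
   hence it is a basis, and unisolvence of the functionals (I, V, L) says that
   their matrix on e is invertible. As rho_k and q_j are orthogonal to affine
   functions, this matrix is block triangular with diagonal blocks A and H. *)
Require Import Defs.
From HB Require Import structures.
From mathcomp Require Import all_boot all_order all_algebra.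
From mathcomp Require mpoly.
Import -(notations) mpoly.
From mathcomp Require Import all_classical all_reals all_analysis.
From mathcomp Require Import measurable_realfun zify.
Set Implicit Arguments.
Unset Strict Implicit.
Unset Printing Implicit Defensive.
Import Order.TTheory GRing.Theory Num.Theory.
Import numFieldNormedType.Exports.
Local Open Scope classical_set_scope.
Local Open Scope ring_scope.

(** * Polynomial functions and barycentric coordinates *)

Section polynomial_functions.
Context (R : realType) (m : nat).
Local Notation T := 'rV[R]_m.
Implicit Types (X Y : set T) (f g : T -> R) (p : mpoly m R).

Local Notation ev p x := (meval (fun i => x ord0 i) p).
Local Notation msize p := (mpoly.msize p).

(** A polynomial of degree at most one is an affine function: a monomial of degree one is a
    coordinate, which is linear, and the constant monomial is handled by the weights summing to
    1. *)
Lemma meval_barycenter p k (u : 'I_k -> R) (w : 'I_k -> T) :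
  (msize p <= 2)%N -> \sum_j u j = 1 ->
  ev p (\sum_j u j *: w j) = \sum_j u j * ev p (w j).
Proof.
move=> p2 u1; rewrite mevalE; under [RHS]eq_bigr do rewrite mevalE mulr_sumr.
rewrite exchange_big /=; apply: eq_big_seq => n np.
(* As [msize] exceeds the degree by one, only monomials of degree 0 or 1 occur. *)
have : (mdeg n < 2)%N by apply: leq_trans p2; exact: msize_mdeg_lt.
under [RHS]eq_bigr do rewrite mulrCA.
rewrite -mulr_sumr ltnS leq_eqVlt ltnS leqn0 mdeg_eq0 => /orP[|/eqP ->].
  move=> /mdeg1P[i /eqP ->]; congr (_ * _).
  have E (h : 'I_m -> R) : \prod_l h l ^+ (mnm1 i l) = h i.
    rewrite (bigD1 i)//= mnm1E eqxx expr1 big1 ?mulr1// => l /negPf li.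
    by rewrite mnm1E eq_sym li.
  rewrite E summxE; apply: eq_bigr => j _.
  by rewrite E mxE.
congr (_ * _); rewrite [LHS]big1 => [|l _]; last by rewrite mnm0E expr0.
by rewrite -[LHS]u1; apply: eq_bigr => j _; rewrite big1 ?mulr1// => l _; rewrite mnm0E.
Qed.

Lemma PspaceS k l X Y f : (k <= l)%N -> Y `<=` X -> Pspace k X f -> Pspace l Y f.
Proof.
move=> kl YX [p pk fp]; exists p => [|x /YX /fp //].
by apply: leq_trans pk _; rewrite ltnS.
Qed.

Lemma Pspace_linear k X (c : R) f g :
  Pspace k X f -> Pspace k X g -> Pspace k X (fun x => c * f x + g x).
Proof.
move=> [p pk fp] [q qk gq]; exists (c *: p + q) => [|x Xx].
  apply: leq_trans (msizeD_le _ _) _; rewrite geq_max qk andbT.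
  exact: leq_trans (msizeZ_le _ _) pk.
by rewrite mevalD mevalZ fp // gq.
Qed.

Lemma Pspace_cst k X (c : R) : Pspace k X (fun=> c).
Proof.
exists (mpolyC m c) => [|x _]; last by rewrite mevalC.
by rewrite msizeC (leq_trans (leq_b1 _)).
Qed.

Lemma Pspace_sum k X (I : Type) (r : seq I) (c : I -> R) (f : I -> T -> R) :
  (forall i, Pspace k X (f i)) -> Pspace k X (fun x => \sum_(i <- r) c i * f i x).
Proof.
move=> kf; elim: r => [|i r IHr].
  by under eq_fun do rewrite big_nil; exact: Pspace_cst.
under eq_fun do rewrite big_cons.
exact: Pspace_linear.
Qed.

Lemma PspaceM k l X f g :
  Pspace k X f -> Pspace l X g -> Pspace (k + l) X (fun x => f x * g x).
Proof.
move=> [p pk fp] [q ql gq]; exists (p * q) => [|x Xx]; last first.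
  by rewrite mevalM fp // gq.
(* The size of a product is the sum of the sizes minus one only for nonzero factors, so zero factors
   are treated first. *)
have [->|p0] := eqVneq p 0; first by rewrite mul0r msize0.
have [->|q0] := eqVneq q 0; first by rewrite mulr0 msize0.
rewrite msizeM // -subn1 leq_subLR add1n.
by rewrite (leq_trans (leq_add pk ql)) // addSn addnS.
Qed.

Lemma Pspace_coord X i : Pspace 1 X (fun x => x ord0 i).
Proof.
by exists (mpolyX R (mnm1 i)) => [|x _]; rewrite ?msizeX ?mdeg1 // mevalXU.
Qed.

Lemma baryE (v : 'I_m.+1 -> T) i x :
  bary v i x = invmx (vertex_mx v) ord0 i +
    \sum_k invmx (vertex_mx v) (rshift 1 k) i * x ord0 k.
Proof.
rewrite /bary mxE (@big_split_ord _ _ _ 1 m) big_ord1 /=.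
congr (_ + _); first by rewrite (row_mxEl _ _ _ (ord0 : 'I_1)) mxE mul1r;
  congr (invmx _ _ _); exact/val_inj.
by apply: eq_bigr => k _; rewrite mulrC; congr (_ * _); exact: row_mxEr.
Qed.

Lemma Pspace_bary (v : 'I_m.+1 -> T) X i : Pspace 1 X (bary v i).
Proof.
rewrite (_ : bary v i = fun x => 1 * invmx (vertex_mx v) ord0 i +
    \sum_k invmx (vertex_mx v) (rshift 1 k) i * x ord0 k); last first.
  by apply/funext => x; rewrite baryE mul1r.
apply: (@Pspace_linear _ _ 1 (fun=> _)); first exact: Pspace_cst.
by apply: Pspace_sum => k; exact: Pspace_coord.
Qed.

(** The coefficients are the values at the vertices of the polynomial representing [f], since each
    point is the barycentric combination of the vertices. *)
Lemma Pspace1_bary (v : 'I_m.+1 -> T) X f : nondeg_simplex v ->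
  Pspace 1 X f -> exists b : 'I_m.+1 -> R,
    forall x, X x -> f x = \sum_i b i * bary v i x.
Proof.
move=> vn [p p2 fp]; exists (fun i => ev p (v i)) => x Xx.
have [b1 bx] := baryP x vn.
rewrite fp // -[in LHS]bx (meval_barycenter _ p2 b1).
by apply: eq_bigr => i _; rewrite mulrC.
Qed.

(** Uniqueness of barycentric coordinates: the row [u] times [vertex_mx v] is the row made of 1 and
    the point, and [vertex_mx v] is invertible. *)
Lemma bary_comb (v : 'I_m.+1 -> T) (u : 'I_m.+1 -> R) i : nondeg_simplex v ->
  \sum_j u j = 1 -> bary v i (\sum_j u j *: v j) = u i.
Proof.
move=> /nondeg_simplex_unit vu u1; rewrite /bary.
have := mul_vertex_mx v (\row_j u j).
under eq_bigr do rewrite mxE; under [in X in row_mx _ X]eq_bigr do rewrite mxE.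
rewrite u1 => /(congr1 (fun M : 'rV[R]_m.+1 => (M *m invmx (vertex_mx v)) ord0 i)).
by rewrite mulmxK // mxE => ->.
Qed.

Lemma measurable_Pspace k f : Pspace k setT f ->
  measurable_fun setT f.
Proof.
move=> [p _ fp].
rewrite (_ : f = fun x => \sum_(n <- msupp p) mcoeff n p *
    \prod_i x ord0 i ^+ n i); last first.
  by apply/funext => x; rewrite fp // mevalE.
apply: measurable_sum => n; apply: measurable_funM => //.
apply: measurable_prod => i _; apply: measurable_funX.
exact: measurable_coord.
Qed.

Lemma Pspace_bounded k X f :
  (exists M, forall x, X x -> forall i, `|x ord0 i| <= M) ->
  Pspace k X f -> exists M, forall x, X x -> `|f x| <= M.
Proof.
move=> [M XM] [p _ fp].
exists (\sum_(n <- msupp p) `|mcoeff n p| * \prod_(i < m) M ^+ n i) => x Xx.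
rewrite fp // mevalE; apply: le_trans (ler_norm_sum _ _ _) _.
apply: ler_sum => n _; rewrite normrM ler_wpM2l // normr_prod.
apply: ler_prod => i _; rewrite normr_ge0 /= normrX.
by apply: lerXn2r; rewrite ?nnegrE ?XM // (le_trans _ (XM x Xx i)).
Qed.

Lemma continuous_Pspace k f : Pspace k setT f -> continuous f.
Proof.
move=> [p _ fp].
rewrite (_ : f = fun x => \sum_(n <- msupp p) mcoeff n p *
    \prod_i x ord0 i ^+ n i); last first.
  by apply/funext => x; rewrite fp // mevalE.
apply: continuous_big => [|n _]; first exact: add_continuous.
move=> x; apply: continuousM; first exact: cst_continuous.
apply: continuous_big => [|i _]; first exact: mul_continuous.
move=> y; apply: (@continuous_comp _ _ _ (fun x : T => x ord0 i)
  (fun t => t ^+ n i)); first exact: coord_continuous.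
exact: exprn_continuous.
Qed.

End polynomial_functions.

(** * Bilinearity of weighted inner products on polynomials *)

Section inner_product.
Context (R : realType) (m : nat) (mu : {measure set 'rV[R]_m -> \bar R}).
Local Notation T := 'rV[R]_m.
Variables (X : set T) (w : T -> R).
Hypothesis mX : measurable X.
Hypothesis bX : exists M, forall x, X x -> forall i, `|x ord0 i| <= M.
Hypothesis iw : mu.-integrable X (EFin \o w).
Implicit Types f g h : T -> R.

(** A bounded measurable factor keeps the density integrable. As [f] is controlled only on [X],
    measurability and the bound are taken from the polynomial representing it. *)
Lemma integrable_Pspace k f : Pspace k X f ->
  mu.-integrable X (EFin \o (fun x => f x * w x)).
Proof.
move=> [p pk fp].
have fX : Pspace k X (fun x => meval (fun i => x ord0 i) p) by exists p.
have [M fM] := Pspace_bounded bX fX.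
apply: (@eq_integrable _ _ _ _ _ mX
  ((EFin \o (fun x => meval (fun i => x ord0 i) p)) \* (EFin \o w))%E) => [x|].
  by rewrite inE => Xx; rewrite /= EFinM fp.
apply: integrableMr => //.
  apply: (measurable_funS measurableT) => //.
  by apply: (@measurable_Pspace _ _ k); exists p.
exists M; split; first exact: num_real.
by move=> N MN x Xx; exact: le_trans (fM _ Xx) (ltW MN).
Qed.

Lemma inner_linearl k l (c : R) f g h : Pspace k X f -> Pspace k X g ->
  Pspace l X h ->
  inner mu X w (fun x => c * f x + g x) h =
  c * inner mu X w f h + inner mu X w g h.
Proof.
move=> Pf Pg Ph; rewrite /inner -RintegralZl //; last first.
  exact: integrable_Pspace (PspaceM Pf Ph).
rewrite -RintegralD //; last 2 first.
(* The product [c * (f * h)] is seen as [c * (f * h) + 0], so that closure under linear combinations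
   applies. *)
- have := integrable_Pspace
    (@Pspace_linear _ _ _ X c _ _ (PspaceM Pf Ph) (@Pspace_cst _ _ _ X 0)).
  by apply: eq_integrable => // x _; rewrite /= addr0 !mulrA.
- exact: integrable_Pspace (PspaceM Pg Ph).
by apply: eq_Rintegral => x _; rewrite !mulrDl !mulrA.
Qed.

Lemma innerC f g : inner mu X w f g = inner mu X w g f.
Proof. by rewrite /inner; under eq_Rintegral do rewrite [_ * g _]mulrC. Qed.

Lemma eq_inner f g f' g' : (forall x, X x -> f x = f' x) ->
  (forall x, X x -> g x = g' x) -> inner mu X w f g = inner mu X w f' g'.
Proof.
move=> ff' gg'; apply: eq_Rintegral => x; rewrite inE => Xx.
by rewrite ff' // gg'.
Qed.

Lemma inner_suml k l (I : Type) (r : seq I) (c : I -> R) (f : I -> T -> R) h :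
  (forall i, Pspace k X (f i)) -> Pspace l X h ->
  inner mu X w (fun x => \sum_(i <- r) c i * f i x) h =
  \sum_(i <- r) c i * inner mu X w (f i) h.
Proof.
move=> Pf Ph; elim: r => [|i r IHr].
  rewrite big_nil /inner; under eq_Rintegral do rewrite big_nil !mul0r.
  by rewrite /Rintegral integral0.
rewrite big_cons -IHr -(inner_linearl _ (Pf i) (Pspace_sum r c Pf) Ph).
by apply: eq_inner => // x _; rewrite big_cons.
Qed.

End inner_product.

(** * Geometry of the simplex and its faces *)

Section simplex_geometry.
Context (R : realType) (m : nat) (v : 'I_m.+1 -> 'rV[R]_m).
Hypothesis vn : nondeg_simplex v.
Local Notation T := 'rV[R]_m.

Lemma hullE : hull v = [set x | forall i, 0 <= bary v i x].
Proof.
apply/seteqP; split => [x [c [c0 c1 ->]] i|x b0].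
  by rewrite bary_comb.
by have [b1 bx] := baryP x vn; exists (bary v ^~ x).
Qed.

Lemma faceE j : face v j = hull v `&` [set x | bary v j x = 0].
Proof.
apply/seteqP; split => [x [c [c0 c1 ->]]|x [xh bj0]].
  (* Weights on the face become weights on the simplex through the value 0 at the vertex [v j]. *)
  pose u k := if unlift j k is Some l then c l else 0.
  have ul l : u (lift j l) = c l by rewrite /u liftK.
  have uj : u j = 0 by rewrite /u unlift_none.
  have u1 : \sum_k u k = 1.
    by rewrite (bigD1_ord j) //= uj add0r -c1; apply: eq_bigr => l _; rewrite ul.
  have -> : \sum_l c l *: face_vertices v j l = \sum_k u k *: v k.
    rewrite [RHS](bigD1_ord j) //= uj scale0r add0r.
    by apply: eq_bigr => l _; rewrite ul.
  split; last by rewrite /= bary_comb.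
  by exists u; split => // k; rewrite /u; case: unlift.
have [b1 bx] := baryP x vn; exists (fun l => bary v (lift j l) x); split.
- by move=> l; move: xh; rewrite hullE; exact.
- by move: b1; rewrite (bigD1_ord j) //= bj0 add0r.
- by rewrite -[LHS]bx (bigD1_ord j) //= bj0 scale0r add0r.
Qed.

Lemma face_sub_hull j : face v j `<=` hull v.
Proof. by rewrite faceE; exact: subIsetl. Qed.

Lemma measurable_bary i : measurable_fun setT (bary v i).
Proof. exact: measurable_Pspace (Pspace_bary v setT i). Qed.

Lemma measurable_hull : measurable (hull v).
Proof.
rewrite hullE (_ : mkset _ = \big[setI/setT]_i (bary v i @^-1` `[0, +oo[)).
  apply: bigsetI_measurable => i _; rewrite -[X in measurable X]setTI.
  exact: measurable_bary.
rewrite -bigcap_seq; apply/seteqP; split => x /= xb i.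
  by rewrite /= in_itv /= andbT.
by have := xb i (mem_index_enum i); rewrite /= in_itv /= andbT.
Qed.

Lemma measurable_face j : measurable (face v j).
Proof.
rewrite faceE; apply: measurableI; first exact: measurable_hull.
by rewrite -[X in measurable X]setTI; exact: (measurable_bary _ _ (measurable_set1 0)).
Qed.

(** Convex weights are at most 1, so the sum of the absolute values of all vertex coordinates is a
    bound. *)
Lemma hull_bounded : exists M, forall x, hull v x -> forall i, `|x ord0 i| <= M.
Proof.
exists (\sum_i \sum_k `|v k ord0 i|) => x [c [c0 c1 ->]] i.
rewrite (bigD1 i) //= -[leLHS]addr0; apply: lerD; last first.
  by apply: sumr_ge0 => l _; exact: sumr_ge0.
rewrite summxE; apply: le_trans (ler_norm_sum _ _ _) _.
apply: ler_sum => k _; rewrite mxE normrM ger0_norm // ler_piMl //.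
by rewrite -c1 (bigD1 k) //= lerDl sumr_ge0.
Qed.

Lemma face_bounded j :
  exists M, forall x, face v j x -> forall i, `|x ord0 i| <= M.
Proof.
by have [M hM] := hull_bounded; exists M => x /face_sub_hull; exact: hM.
Qed.

Lemma hull_comb (u : 'I_m.+1 -> R) : (forall i, 0 <= u i) -> \sum_i u i = 1 ->
  hull v (\sum_i u i *: v i).
Proof. by move=> u0 u1; exists u. Qed.

(** Finitely many strict inequalities between continuous functions persist in a neighbourhood. *)
Lemma interior_hull x : (forall i, 0 < bary v i x) -> interior (hull v) x.
Proof.
move=> b0; suff : \forall y \near x, forall i, 0 < bary v i y.
  by apply: filterS => y yb; rewrite hullE => i; exact/ltW/yb.
apply: (@filter_forall _ _ (fun i y => 0 < bary v i y) _ (nbhs_filter x)) => i.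
exact: (@cvgr_gt _ _ _ (nbhs_filter x) _ _
  (continuous_Pspace (Pspace_bary v setT i) (x := x)) _ (b0 i)).
Qed.

(** With S the sum of the [a i], evaluation at one well-chosen interior point per vertex gives S +
    a_j = 0 for all j; summing over j gives (m + 2) S = 0, so S and then every a_j vanishes. *)
Lemma bary_interior_eq0 (a : 'I_m.+1 -> R) :
  (forall x, interior (hull v) x -> \sum_i a i * bary v i x = 0) ->
  forall i, a i = 0.
Proof.
move=> a0.
have m2 : 0 < m.+2%:R :> R by [].
have E j : \sum_i a i + a j = 0.
  (* All weights are positive, which makes the point interior; the vertex [v j] counts twice, whence
     the denominator m + 2. *)
  pose u i : R := (1 + (i == j)%:R) / m.+2%:R.
  have sdelta (b : 'I_m.+1 -> R) : \sum_i b i * (i == j)%:R = b j.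
    rewrite (bigD1 j) //= eqxx mulr1 big1 ?addr0 // => i /negPf ->.
    by rewrite mulr0.
  have u1 : \sum_i u i = 1.
    rewrite -mulr_suml big_split /= sumr_const card_ord.
    under [X in _ + X]eq_bigr do rewrite -[(_ == _)%:R]mul1r.
    by rewrite (sdelta (fun=> 1)) natr1 divff // gt_eqF.
  have /a0 : interior (hull v) (\sum_i u i *: v i).
    by apply: interior_hull => i; rewrite bary_comb // divr_gt0 // ltr_wpDr.
  under eq_bigr do rewrite bary_comb // mulrA mulrDr mulr1.
  rewrite -mulr_suml big_split /= sdelta => /eqP.
  by rewrite mulf_eq0 invr_eq0 (gt_eqF m2) orbF => /eqP.
have aE j : a j = - \sum_i a i by apply/eqP; rewrite -addr_eq0 addrC E.
have /eqP : (\sum_i a i) *+ m.+2 = 0.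
  rewrite mulrS; have -> : (\sum_i a i) *+ m.+1 = - \sum_j a j.
    rewrite [in RHS](eq_bigr _ (fun j _ => aE j)) sumrN opprK.
    by rewrite sumr_const card_ord.
  by rewrite subrr.
by rewrite mulrn_eq0 /= => /eqP S0 i; rewrite aE S0 oppr0.
Qed.
End simplex_geometry.

(** * Definiteness of the inner product on affine functions *)

Section definiteness.
Context (R : realType) (m : nat) (v : 'I_m.+1 -> 'rV[R]_m).
Hypothesis vn : nondeg_simplex v.
Variable w : 'rV[R]_m -> R.
Hypothesis w_density : prob_density (lebesgue_rV m) (hull v) w.
Hypothesis w_gt0 : {ae lebesgue_rV m, forall x, interior (hull v) x -> 0 < w x}.

(** A ball of radius e for the sup norm is a box, of Lebesgue measure (2e)^m > 0. *)
Lemma interior_not_negligible (U : set 'rV[R]_m) x :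
  interior U x -> ~ (lebesgue_rV m).-negligible U.
Proof.
move=> /nbhs_ballP[e /= e0 xU].
pose B := [set y : 'rV[R]_m | forall i, (ball (x ord0 i) e) (y ord0 i)].
have mb i : measurable (ball (x ord0 i) e : set (measurableTypeR R)).
  exact: measurable_ball.
have BU : B `<=` U.
  by move=> y By; apply: xU; split => // i j; rewrite (ord1 i); exact: By.
have muB : lebesgue_rV m B = ((e *+ 2) ^+ m)%:E.
  rewrite /B (lebesgue_rV_box mb).
  under eq_bigr do rewrite lebesgue_measure_ball ?ltW //.
  by rewrite prodEFin prodr_const card_ord.
move=> /(negligibleS BU) [N [mN N0 BN]].
have : (0 < lebesgue_rV m N)%E.
  have mB : measurable B.
    rewrite (_ : B = \big[setI/setT]_i
        ((fun y : 'rV[R]_m => y ord0 i) @^-1` ball (x ord0 i) e)).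
      apply: bigsetI_measurable => i _; rewrite -[X in measurable X]setTI.
      exact: measurable_coord.
    rewrite -bigcap_seq; apply/seteqP; split => y /= yb i; first by move=> _; exact: yb.
    exact: yb i (mem_index_enum i).
  have muB0 : (0 < lebesgue_rV m B)%E by rewrite muB lte_fin exprn_gt0 // mulrn_wgt0.
  by apply: lt_le_trans muB0 _; apply: le_measure; rewrite ?inE.
by rewrite N0 ltxx.
Qed.

(** The integral of f^2 w vanishes, so f = 0 almost everywhere in the interior, where w > 0. A
    nonzero value at an interior point would persist on a neighbourhood, which is not negligible. *)
Lemma inner_definite f : Pspace 1 setT f ->
  inner (lebesgue_rV m) (hull v) w f f = 0 ->
  forall x, interior (hull v) x -> f x = 0.
Proof.
have [iw w0 _] := w_density => Pf ff0 x xh.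
have mh := measurable_hull vn.
have PfX : Pspace 1 (hull v) f by exact: PspaceS Pf.
pose g := EFin \o (fun y => f y * f y * w y).
have ig : (lebesgue_rV m).-integrable (hull v) g.
  by have := integrable_Pspace mh (hull_bounded v) iw (PspaceM PfX PfX).
have mg := measurable_int _ ig.
have : (\int[lebesgue_rV m]_(y in hull v) g y = 0)%E.
  by rewrite -[LHS]fineK ?integrable_fin_num //; congr EFin.
(* The density is nonnegative only almost everywhere, so the integrand is first exchanged for its
   absolute value. *)
rewrite (@ae_eq_integral _ _ _ _ _ (abse \o g)) //; last 2 first.
- exact: measurableT_comp.
- apply: filterS w0 => y wy hy /=.
  by rewrite ger0_norm // mulr_ge0 ?wy // -expr2 sqr_ge0.
move=> /(ae_eq_integral_abs _ mh mg) g0.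
have : {ae lebesgue_rV m, forall y, interior (hull v) y -> f y = 0}.
  apply: filterS2 g0 w_gt0 => y gy wy yh.
  have [] := gy (interior_subset yh).
  by move=> /eqP; rewrite !mulf_eq0 (gt_eqF (wy yh)) orbF orbb => /eqP.
move=> fN; apply: contrapT => /eqP fx0.
apply: (@interior_not_negligible _ x _ fN).
have fn0 : \forall y \near x, f y != 0.
  exact: (@cvgr_neq0 _ _ _ _ (nbhs_filter x) _ _ (continuous_Pspace Pf (x := x)) fx0).
have : nbhs x (interior (hull v)) by exact: nbhs_interior.
move: fn0; rewrite /interior; apply: filterS2 => y fy yh.
by move=> /(_ yh) /eqP; rewrite (negbTE fy).
Qed.

Lemma inner_bary_definite (a : 'I_m.+1 -> R) :
  let f x := \sum_i a i * bary v i x in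
  inner (lebesgue_rV m) (hull v) w f f = 0 -> forall i, a i = 0.
Proof.
move=> f ff0; apply: (bary_interior_eq0 vn) => x xh.
apply: (inner_definite (f := f)) => //.
by apply: Pspace_sum => i; exact: Pspace_bary.
Qed.

End definiteness.

(** * Free families, spanning families and unisolvence *)

Section linear_algebra.
Context (R : realType) (m : nat).
Local Notation T := 'rV[R]_m.
Implicit Types (X : set T) (P : set (T -> R)).

(** Both families have N members, so the matrix M expressing [L] through [e] is square. Freeness of
    [L] makes it invertible, and a relation c among the [e s] turns into the relation c M^-1 among
    the [L r]. *)
Lemma span_free X N (e L : 'I_N -> T -> R) :
  free_on X L -> (forall r, span_on X e (L r)) -> free_on X e.
Proof.
move=> Lfree /choice[t Lt].
pose M := \matrix_(r, s) t r s.
have comb (u : 'rV[R]_N) x : X x ->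
    \sum_r u ord0 r * L r x = \sum_s (u *m M) ord0 s * e s x.
  move=> Xx; under eq_bigr do rewrite Lt // mulr_sumr.
  rewrite exchange_big; apply: eq_bigr => s _; rewrite mxE mulr_suml.
  by apply: eq_bigr => r _; rewrite mxE mulrA.
have uM : M \in unitmx.
  rewrite -row_free_unit -kermx_eq0; apply/rowV0P => u /sub_kermxP uM0.
  apply/rowP => r; rewrite mxE; apply: (Lfree (u ord0)) => x Xx.
  by rewrite comb // uM0 big1 // => s _; rewrite mxE mul0r.
move=> c c0; pose u := \row_s c s *m invmx M.
have u0 : u = 0.
  apply/rowP => r; rewrite [RHS]mxE; apply: (Lfree (u ord0)) => x Xx.
  rewrite comb // mulmxKV //; rewrite -[RHS](c0 x Xx).
  by apply: eq_bigr => s _; rewrite mxE.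
move=> s; have := congr1 (fun y : 'rV[R]_N => (y *m M) ord0 s) u0.
by rewrite mulmxKV // mul0mx !mxE.
Qed.

(** In coordinates on the basis [e], the functionals send the coefficient vector c to K c, so
    unisolvence says that the square matrix K has trivial kernel. Coefficients are kept as rows,
    hence the transpose of K. *)
Lemma unisolvent_unitmx X P N (e : 'I_N -> T -> R) (F : 'I_N -> (T -> R) -> R) :
  free_on X e -> (forall p, P p <-> span_on X e p) ->
  (forall r c p, (forall x, X x -> p x = \sum_s c s * e s x) ->
    F r p = \sum_s c s * F r (e s)) ->
  unisolvent (range F) X P <-> \matrix_(r, s) F r (e s) \in unitmx.
Proof.
move=> efree Pe linF; set K := \matrix_(r, s) _.
have FK r c : \sum_s c s * F r (e s) = (\row_s c s *m K^T) ord0 r.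
  by rewrite mxE; apply: eq_bigr => s _; rewrite !mxE.
split=> [uni|uK p /Pe[c pc] Fp0 x Xx].
  rewrite -unitmx_tr -row_free_unit -kermx_eq0.
  apply/rowV0P => u /sub_kermxP uK0.
  pose p x := \sum_s u ord0 s * e s x.
  apply/rowP => s; rewrite mxE; apply: (efree (u ord0)) => x Xx.
  apply: (uni p) => //; first by apply/Pe; exists (u ord0).
  move=> _ [r _ <-]; rewrite (linF r (u ord0)) // FK.
  rewrite (_ : \row_s _ = u) ?uK0 ?mxE //.
  by apply/rowP => j; rewrite mxE.
have c0 : \row_s c s = 0.
  apply: (can_inj (mulmxK (_ : K^T \in unitmx))); first by rewrite unitmx_tr.
  rewrite mul0mx; apply/rowP => r; rewrite -FK -(linF r c p pc) [RHS]mxE.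
  by apply: Fp0; exists r.
rewrite pc // big1 // => s _.
by have := congr1 (fun y : 'rV[R]_N => y ord0 s) c0; rewrite !mxE => ->; rewrite mul0r.
Qed.

End linear_algebra.

(** * Concatenation of finite families *)

Section family_cat.
Context (A : Type) (k l : nat).

(** The index set is split as the rows and columns of [block_mx] are, so that concatenated families
    produce block matrices. *)
Definition fcat (f : 'I_k -> A) (g : 'I_l -> A) (i : 'I_(k + l)) : A :=
  match fintype.split i with inl j => f j | inr j => g j end.

Lemma fcatl f g i : fcat f g (lshift l i) = f i.
Proof. by rewrite /fcat (unsplitK (inl _ i)). Qed.

Lemma fcatr f g i : fcat f g (rshift k i) = g i.
Proof. by rewrite /fcat (unsplitK (inr _ i)). Qed.

Lemma fcatP (Q : A -> Prop) f g :
  (forall i, Q (f i)) -> (forall i, Q (g i)) -> forall i, Q (fcat f g i).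
Proof. by move=> Qf Qg i; rewrite /fcat; case: fintype.split. Qed.

Lemma range_fcat f g : range (fcat f g) = range f `|` range g.
Proof.
apply/seteqP; split => [_ [i _ <-]|a].
  by apply: fcatP => j; [left|right]; exists j.
by case=> -[i _ <-]; [exists (lshift l i)|exists (rshift k i)];
  rewrite ?fcatl ?fcatr.
Qed.

End family_cat.

Lemma sum_fcat (R : realType) (B : Type) k l (c : 'I_k -> R) (c' : 'I_l -> R)
    (f : 'I_k -> B -> R) (g : 'I_l -> B -> R) x :
  \sum_s fcat c c' s * fcat f g s x = \sum_i c i * f i x + \sum_i c' i * g i x.
Proof.
rewrite big_split_ord /=; congr (_ + _).
  by apply: eq_bigr => i _; rewrite !fcatl.
by apply: eq_bigr => i _; rewrite !fcatr.
Qed.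

(** * Independent quadratic products and the dimension count *)

Lemma card_pairs_le n : #|[pred p : 'I_n * 'I_n | (p.2 <= p.1)%N]| = 'C(n.+1, 2).
Proof.
rewrite -sum1_card.
rewrite -(pair_big_dep xpredT (fun i j : 'I_n => j <= i)%N (fun _ _ => 1%N)) /=.
rewrite -bin2_sum big_nat_recl //= add0n big_mkord; apply: eq_bigr => i _.
rewrite (big_ord_narrow (F := fun _ : 'I_n => 1%N) (ltn_ord i)) /=.
by rewrite sum_nat_const card_ord muln1.
Qed.

Section quadratic_basis.
Context (R : realType) (m : nat) (v : 'I_m.+1 -> 'rV[R]_m).
Hypothesis vn : nondeg_simplex v.

(* The coefficients of a combination of the products lambda_i lambda_j are read
   off at the vertices first, and then at the edge midpoints. *)
Lemma free_quadratics N : N = 'C(m.+2, 2) -> exists L : 'I_N -> 'rV[R]_m -> R,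
  (forall r, Pspace 2 (hull v) (L r)) /\ free_on (hull v) L.
Proof.
rewrite -card_pairs_le => ->.
set P := [pred p : 'I_m.+1 * 'I_m.+1 | (p.2 <= p.1)%N].
pose ij (r : 'I_#|P|) := enum_val r.
exists (fun r x => bary v (ij r).1 x * bary v (ij r).2 x); split => [r|c c0].
  by apply: (@PspaceM _ _ 1 1); exact: Pspace_bary.
have ijP r : ((ij r).2 <= (ij r).1)%N.
  by have := enum_valP r; rewrite inE.
(* Evaluation at the midpoint of the vertices i and j of [r0] (the vertex itself if i = j) kills
   every product with an index outside {i, j}. Thus [c r0] vanishes once the other products with
   indices in {i, j} have coefficient 0. *)
have E r0 : (forall r, r != r0 -> (ij r).1 \in [:: (ij r0).1; (ij r0).2] ->
    (ij r).2 \in [:: (ij r0).1; (ij r0).2] -> c r = 0) -> c r0 = 0.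
  move=> H; case Er0 : (ij r0) H => [i j] /= H.
  pose u k : R := ((k == i)%:R + (k == j)%:R) / 2.
  have u0 k : 0 <= u k by rewrite divr_ge0 // addr_ge0.
  have sdelta l : \sum_k (k == l :> 'I_m.+1)%:R = 1 :> R.
    by rewrite (bigD1 l) //= eqxx big1 ?addr0 // => k /negPf ->.
  have u1 : \sum_k u k = 1.
    by rewrite -mulr_suml big_split /= !sdelta -[1 + 1]/(2%:R) divff.
  have uN k : k \notin [:: i; j] -> u k = 0.
    by rewrite !inE negb_or /u => /andP[/negPf -> /negPf ->]; rewrite addr0 mul0r.
  have := c0 _ (hull_comb v u0 u1); under eq_bigr do rewrite !bary_comb //.
  rewrite (bigD1 r0) //= big1 ?addr0 => [|r rr0]; last first.
    case: (boolP ((ij r).1 \in [:: i; j])) => [r1|/uN ->]; last by rewrite mul0r mulr0.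
    case: (boolP ((ij r).2 \in [:: i; j])) => [r2|/uN ->]; last by rewrite !mulr0.
    by rewrite (H r) ?mul0r.
  have ui : 0 < u i by rewrite /u eqxx divr_gt0 // ltr_wpDr.
  have uj : 0 < u j by rewrite /u eqxx divr_gt0 // ltr_wpDl.
  by rewrite Er0 /= => /eqP; rewrite mulf_eq0 (gt_eqF (mulr_gt0 ui uj)) orbF => /eqP.
have diag r : (ij r).1 = (ij r).2 -> c r = 0.
  move=> rd; apply: E => s sr; rewrite rd !inE !orbb => /eqP s1 /eqP s2.
  case/eqP: sr; apply: enum_val_inj; rewrite -/(ij s) -/(ij r).
  by move: s1 s2 rd; case: (ij s) (ij r) => ? ? [? ?] /= -> -> ->.
(* The squares are already settled by [diag]; a product of two distinct indices in {i, j} can only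
   be [r] itself, because the pairs are ordered. *)
move=> r; apply: E => s sr s1 s2.
case: (eqVneq (ij s).1 (ij s).2) => [/diag //|sne].
case/eqP: sr; apply: enum_val_inj; rewrite -/(ij s) -/(ij r).
have := ijP s; have := ijP r; move: s1 s2 sne.
case: (ij s) (ij r) => a b [i j] /=; rewrite !inE.
move=> /orP[]/eqP -> /orP[]/eqP ->; rewrite ?eqxx // => ji le1 le2.
by case/eqP: ji; apply/val_inj/anti_leq; rewrite le1 le2.
Qed.

End quadratic_basis.

(** The left side counts the barycentric coordinates, the functions rho and the functions psi; the
    right side is the number of products lambda_i lambda_j with i <= j. *)
Lemma dim_quadratic d : (2 <= d)%N ->
  (d.+1 + (((d - 2) * (d + 1))./2 + d.+1))%N = 'C(d.+2, 2).
Proof.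
case: d => [|[|k]] // _; rewrite bin2 subSS subSS subn0 succnK.
(* With d = k + 2, twice the dimension is k (k + 3) + 4 (k + 3). The second summand is even, so
   halving distributes over the sum without a carry. *)
have -> : (k.+4 * k.+3 = k * (k.+2 + 1) + (k.+3).*2.*2)%N by lia.
by rewrite halfD odd_double andbF add0n doubleK -addnn addnCA.
Qed.

(** * Orthogonal projection onto affine functions *)

Section orthogonal_decomposition.
Context (R : realType) (m : nat) (v : 'I_m.+1 -> 'rV[R]_m).
Hypothesis vn : nondeg_simplex v.
Variable w : 'rV[R]_m -> R.
Hypothesis w_density : prob_density (lebesgue_rV m) (hull v) w.
Hypothesis w_gt0 : {ae lebesgue_rV m, forall x, interior (hull v) x -> 0 < w x}.
Local Notation ip := (inner (lebesgue_rV m) (hull v) w).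

Let mh : measurable (hull v) := measurable_hull vn.
Let bh := hull_bounded v.
Let iw : (lebesgue_rV m).-integrable (hull v) (EFin \o w).
Proof. by have [] := w_density. Qed.

(** If u is in the kernel, then f = sum u_i lambda_i satisfies <f, f> = 0, and definiteness gives u
    = 0. *)
Lemma bary_gram_unit :
  \matrix_(i, j) ip (bary v i) (bary v j) \in unitmx.
Proof.
set G := \matrix_(i, j) _.
rewrite -row_free_unit -kermx_eq0; apply/rowV0P => u /sub_kermxP uG0.
apply/rowP => i; rewrite mxE.
apply: (inner_bary_definite vn w_density w_gt0 (a := u ord0)) => /=.
have Pb i0 : Pspace 1 (hull v) (bary v i0) by exact: Pspace_bary.
rewrite (inner_suml mh bh iw _ _ Pb (Pspace_sum _ _ Pb)) big1 // => j _.
rewrite innerC (inner_suml mh bh iw _ _ Pb (Pb j)).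
have := congr1 (fun y : 'rV[R]_m.+1 => y ord0 j) uG0; rewrite !mxE => uGj.
under eq_bigr => k _ do
  rewrite -[ip _ _](mxE matrix_key (fun i j => ip (bary v i) (bary v j))).
by rewrite uGj mulr0.
Qed.

(** The coefficients [a] solve the normal equations, whose Gram matrix is invertible, and [s] is the
    residual of the projection. *)
Lemma Pspace2_decomposition p : Pspace 2 (hull v) p ->
  exists (a : 'I_m.+1 -> R) s, orth_quadratic (lebesgue_rV m) (hull v) w s /\
    forall x, p x = \sum_i a i * bary v i x + s x.
Proof.
move=> Pp; have uG := bary_gram_unit; set G := \matrix_(i, j) _ in uG.
have Pb k i : (0 < k)%N -> Pspace k (hull v) (bary v i).
  by move=> k0; apply: PspaceS (Pspace_bary v (hull v) i).
pose b := \row_j ip p (bary v j) : 'rV[R]_m.+1.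
pose a i := (b *m invmx G) ord0 i.
pose s x := (-1) * (\sum_i a i * bary v i x) + p x.
have Ps : Pspace 2 (hull v) s.
  by apply: Pspace_linear Pp; apply: Pspace_sum => i; exact: Pb.
exists a, s; split; last by move=> x; rewrite /s mulN1r addrA subrr add0r.
split=> // f /(Pspace1_bary vn)[c fc].
have -> : ip s f = ip s (fun x => \sum_i c i * bary v i x) by exact: eq_inner.
rewrite innerC.
rewrite (inner_suml mh bh iw _ _ (fun i => Pb 1 i isT) Ps) big1 // => j _.
rewrite innerC (inner_linearl mh bh iw _ _ Pp (Pb 1 j isT)); last first.
  by apply: Pspace_sum => i; exact: Pb.
rewrite (inner_suml mh bh iw _ _ (fun i => Pb 1 i isT) (Pb 1 j isT)).
have : (b *m invmx G *m G) ord0 j = b ord0 j by rewrite mulmxKV.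
rewrite mxE [RHS]mxE => <-; under [X in _ + X]eq_bigr do rewrite [G _ _]mxE.
by rewrite mulN1r addNr mulr0.
Qed.

End orthogonal_decomposition.

(** * The block triangular matrix of the functionals *)

Theorem corollary1 (R : realType) (d : nat) (hd : (2 <= d)%N)
  (v : 'I_d.+1 -> 'rV[R]_d) (hv : nondeg_simplex v)
  (Omega : 'rV[R]_d -> R)
  (hOmega : prob_density (lebesgue_rV d) (hull v) Omega)
  (hOmega_pos :
    {ae lebesgue_rV d, forall x, interior (hull v) x -> 0 < Omega x})
  (omega : 'I_d.+1 -> 'rV[R]_d -> R)
  (homega : forall j, prob_density (face_measure v j) (face v j) (omega j))
  (homega_pos : forall j,
    {ae face_measure v j, forall x, face v j x -> 0 < omega j x})
  (homega_trace : forall j, face_trace v Omega j (omega j))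
  (dt := (((d - 2) * (d + 1))./2)%N)
  (rho : 'I_dt -> 'rV[R]_d -> R)
  (S2 := orth_quadratic (lebesgue_rV d) (hull v) Omega)
  (hrho : forall k, S2 (rho k))
  (hrho_free : free_on (hull v) rho)
  (psi : 'I_d.+1 -> 'rV[R]_d -> R)
  (hpsi : forall j, S2 (psi j))
  (hsum : direct_sum_on (hull v) S2
            (span_on (hull v) rho) (span_on (hull v) psi))
  (q : 'I_d.+1 -> 'rV[R]_d -> R)
  (hq : forall j, orth_quadratic (face_measure v j) (face v j) (omega j) (q j)) :
  let I j f := inner (face_measure v j) (face v j) (omega j) f (fun=> 1) in
  let L j f := inner (face_measure v j) (face v j) (omega j) f (q j) in
  let V k f := inner (lebesgue_rV d) (hull v) Omega f (rho k) in
  let A := \matrix_(j < d.+1, i < d.+1) I j (bary v i) in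
  let G := \matrix_(k < dt, l < dt) V k (rho l) in
  let C := \matrix_(k < dt, i < d.+1) V k (psi i) in
  let Ct := \matrix_(j < d.+1, l < dt) L j (rho l) in
  let M := \matrix_(j < d.+1, i < d.+1) L j (psi i) in
  let H := block_mx G C Ct M in
  unisolvent (range I `|` range L `|` range V) (hull v) (Pspace 2 (hull v))
  <-> (A \in unitmx /\ H \in unitmx).
Proof.
move=> I L V A G C Ct M H; set X := hull v.
have mX := measurable_hull hv; have bX := hull_bounded v.
have [iOmega _ _] := hOmega.
have iomega j : (face_measure v j).-integrable (face v j) (EFin \o omega j).
  by have [] := homega j.
have mF := measurable_face hv; have bF := face_bounded hv.
have fX j : face v j `<=` X := @face_sub_hull _ _ _ hv j.
(* [V] precedes [L] so that the rows match those of [H]. *)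
pose e := fcat (bary v) (fcat rho psi); pose F := fcat I (fcat V L).
have Pb Y i : Pspace 1 Y (bary v i) by exact: Pspace_bary.
have Pe s : Pspace 2 X (e s).
  apply: fcatP s => [i|]; first exact: PspaceS (Pb X i).
  by apply: fcatP => i; [have [] := hrho i|have [] := hpsi i].
have PeP p : Pspace 2 X p <-> span_on X e p.
  split=> [Pp|[c pc]]; last first.
    have [P0 P0s P0E] := @Pspace_sum _ _ 2 X _ (index_enum _) c e Pe.
    by exists P0 => // x Xx; rewrite pc // P0E.
  (* The affine part is expanded in the lambda_i; the residual lies in S_2 and splits along the
     direct sum into combinations of [rho] and [psi]. *)
  have [a [s [/(proj1 hsum)[g [h [[c gc] [c' hc'] sgh]]] pE]]] :=
    Pspace2_decomposition hv hOmega hOmega_pos Pp.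
  exists (fcat a (fcat c c')) => x Xx.
  by rewrite sum_fcat sum_fcat -gc // -hc' // -sgh.
(* The spanning family [e] has as many members as a free family in P_2, hence it is free. *)
have efree : free_on X e.
  have [Lam [LamP Lamfree]] := free_quadratics hv (dim_quadratic hd).
  by apply: span_free Lamfree _ => r; exact/PeP.
(* The expansion of [p] holds only on the simplex; this suffices for the face functionals because
   the faces lie in it. *)
have linF r c p : (forall x, X x -> p x = \sum_s c s * e s x) ->
    F r p = \sum_s c s * F r (e s).
  move=> pc; pose p' x := \sum_s c s * e s x.
  have PeF j s : Pspace 2 (face v j) (e s) by exact: PspaceS (Pe s).
  have linface j k g : Pspace k (face v j) g ->
      inner (face_measure v j) (face v j) (omega j) p g =
      \sum_s c s * inner (face_measure v j) (face v j) (omega j) (e s) g.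
    move=> Pg; rewrite -(inner_suml (mF j) (bF j) (iomega j) _ _ (PeF j) Pg).
    by apply: eq_inner => // x /fX; exact: pc.
  apply: (fcatP (Q := fun G : ('rV[R]_d -> R) -> R =>
    G p = \sum_s c s * G (e s))) r => [j|].
    by apply: linface; exact: (@Pspace_cst _ _ 0).
  apply: (fcatP (Q := fun G : ('rV[R]_d -> R) -> R =>
    G p = \sum_s c s * G (e s))) => [k|j]; last first.
    by have [Pq _] := hq j; exact: linface Pq.
  have [Pr _] := hrho k.
  rewrite /V -(inner_suml mX bX iOmega _ _ Pe Pr).
  by apply: eq_inner.
have FE : range I `|` range L `|` range V = range F.
  by rewrite /F !range_fcat -setUA [range L `|` _]setUC.
rewrite FE (unisolvent_unitmx efree PeP linF).
(* The face averages of [rho] and [psi] form a block above the diagonal, which drops out of the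
   determinant. *)
pose B := \matrix_(j < d.+1, s < dt + d.+1) I j (fcat rho psi s).
have -> : \matrix_(r, s) F r (e s) = block_mx A B 0 H.
  apply/matrixP => r s; rewrite mxE.
  case: (split_ordP r) => j ->; case: (split_ordP s) => i ->;
    rewrite ?(block_mxEul, block_mxEur, block_mxEdl, block_mxEdr) /F /e
      !(fcatl, fcatr).
  - by rewrite mxE.
  - by rewrite mxE.
  (* The lower left block vanishes: [rho k] is orthogonal to affine functions on the simplex, and
     [q k] on its face. *)
  - rewrite mxE; apply: (fcatP (Q := fun G : ('rV[R]_d -> R) -> R =>
      G (bary v i) = 0)) j => k.
      by have [_ ro] := hrho k; rewrite /V innerC ro.
    by have [_ qo] := hq k; rewrite /L innerC qo.
  case: (split_ordP j) => {}j ->; case: (split_ordP i) => {}i ->;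
    rewrite ?(block_mxEul, block_mxEur, block_mxEdl, block_mxEdr)
      !(fcatl, fcatr) mxE //.
rewrite !unitmxE det_ublock unitrM.
by split=> [/andP|[-> ->]].
Qed.
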